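(* Let $\theta=(\theta_1,\dots,\theta_n)\in\mathbb{R}^{nd}$ and consider the optimization problem $$V(\theta)=\min_{x=(x_0,\dots,x_N)\in\mathbb{R}_+^{N+1}}\left(\sum_{i=0}^{N-1}\frac{\Delta s_i}{\sqrt{x_i}}\right)^2$$ subject to $$-\dot{\underline q}_j^2\le v_{ij}(\theta,x)\le\dot{\overline q}_j^2\quad(i=0,\dots,N,\ j=1,\dots,n),\qquad \ddot{\underline q}_j\le a_{ij}(\theta,x)\le\ddot{\overline q}_j\quad(i=0,\dots,N-1,\ j=1,\dots,n),$$ where $x_i$ stands for the squared path speed $\dot s_i^2$ and $$v_{ij}(\theta,x)=\operatorname{sign}(p_i'\theta_j)(p_i'\theta_j)^2x_i,\qquad a_{ij}(\theta,x)=\left(p_i''\theta_j-\frac{p_i'\theta_j}{2\Delta s_i}\right)x_i+\frac{p_i'\theta_j}{2\Delta s_i}x_{i+1}.$$ Let $\mathcal{L}_I$ be its Lagrangian $$\mathcal{L}_I(\theta,x,\zeta)=\left(\sum_{i=0}^{N-1}\frac{\Delta s_i}{\sqrt{x_i}}\right)^2+\sum_{i=0}^{N}\sum_{j=1}^n\Big[\zeta^+_{vij}\big(v_{ij}(\theta,x)-\dot{\overline q}_j^2\big)+\zeta^-_{vij}\big(-v_{ij}(\theta,x)-\dot{\underline q}_j^2\big)\Big]+\sum_{i=0}^{N-1}\sum_{j=1}^n\Big[\zeta^+_{aij}\big(a_{ij}(\theta,x)-\ddot{\overline q}_j\big)+\zeta^-_{aij}\big(-a_{ij}(\theta,x)+\ddot{\underline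 q}_j\big)\Big],$$ with multiplier vector $\zeta=(\zeta_v^+,\zeta_v^-,\zeta_a^+,\zeta_a^-)\in\mathbb{R}_+^{2n(2N+1)}$. Let $(x^\star,\zeta^\star)$ be a primal-dual solution of this problem for the given $\theta$. Then $$\left(\frac{\partial\mathcal{L}_I(\theta,x^\star,\zeta^\star)}{\partial\theta}\right)^{T}\theta\ \ge\ 0,$$ where the partial derivative is taken with respect to $\theta\in\mathbb{R}^{nd}$ with $x^\star$ and $\zeta^\star$ held fixed.
   Context: $N,n,d$ are positive integers. $0=s_0<s_1<\dots<s_N=1$ are path points and $\Delta s_i=s_{i+1}-s_i>0$. The function $p:\mathbb{R}\to\mathbb{R}^{1\times d}$ is a twice differentiable row-vector basis; $p_i'=p'(s_i)$, $p_i''=p''(s_i)$, and $\theta_j\in\mathbb{R}^d$, so $p_i'\theta_j,\ p_i''\theta_j\in\mathbb{R}$. For each joint $j$, the velocity limits satisfy $\dot{\underline q}_j<0<\dot{\overline q}_j$ and the acceleration limits satisfy $\ddot{\underline q}_j<0<\ddot{\overline q}_j$. $\operatorname{sign}(0)=0$. The objective is $+\infty$ when some $x_i=0$, $0\le i\le N-1$. A primal-dual solution $(x^\star,\zeta^\star)$ means: $x^\star$ is an optimal solution of the constrained problem, and $\zeta^\star\in\operatorname{argmax}_{\zeta\ge0}\min_{x\in\mathbb{R}_+^{N+1}}\mathcal{L}_I(\theta,x,\zeta)$ is an optimal solution of the Lagrangian dual problem. *)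

(* Defs.v *)
From mathcomp Require Import all_boot all_order all_algebra.
From mathcomp Require Import all_classical all_reals all_analysis.

Set Implicit Arguments.
Unset Strict Implicit.
Unset Printing Implicit Defensive.
Import Order.TTheory GRing.Theory Num.Theory.
Import numFieldNormedType.Exports.
Local Open Scope classical_set_scope.
Local Open Scope ring_scope.

(* [knot i] is s_i; [pbasis] is the row-vector basis p; [vlo j], [vhi j],
   [alo j], [ahi j] are the lower/upper velocity and lower/upper acceleration
   limits of joint j. *)
Record path_data (R : realType) (N n d : nat) := PathData {
  knot  : 'I_N.+1 -> R;
  pbasis : R -> 'rV[R]_d;
  vlo : 'I_n -> R;
  vhi : 'I_n -> R;
  alo : 'I_n -> R;
  ahi : 'I_n -> R }.

(* The multipliers zeta_v^+, zeta_v^-, zeta_a^+, zeta_a^-. *)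
Record multiplier (R : realType) (N n : nat) := Multiplier {
  zvp : 'M[R]_(N.+1, n);
  zvm : 'M[R]_(N.+1, n);
  zap : 'M[R]_(N, n);
  zam : 'M[R]_(N, n) }.

(* For an interval index i = 0, ..., N-1, the knot indices i and i+1. *)
Definition lft (N : nat) (i : 'I_N) : 'I_N.+1 := widen_ord (leqnSn N) i.
Definition rgt (N : nat) (i : 'I_N) : 'I_N.+1 := lift ord0 i.

Definition nonneg_vec (R : realType) (N : nat) (x : 'rV[R]_N.+1) : Prop :=
  forall i, 0 <= x 0 i.

Definition nonneg_mult (R : realType) (N n : nat) (z : multiplier R N n) : Prop :=
  [/\ forall i j, 0 <= zvp z i j, forall i j, 0 <= zvm z i j,
      forall i j, 0 <= zap z i j & forall i j, 0 <= zam z i j].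

Definition ds (R : realType) (N n d : nat) (D : path_data R N n d) (i : 'I_N) : R :=
  knot D (rgt i) - knot D (lft i).

(* theta in R^{nd} is a d x n matrix whose j-th column is theta_j, so these
   are p_i' theta_j and p_i'' theta_j. *)
Definition dq (R : realType) (N n d : nat) (D : path_data R N n d)
    (th : 'M[R]_(d, n)) (i : 'I_N.+1) (j : 'I_n) : R :=
  (derive1 (pbasis D) (knot D i) *m col j th) 0 0.

Definition ddq (R : realType) (N n d : nat) (D : path_data R N n d)
    (th : 'M[R]_(d, n)) (i : 'I_N.+1) (j : 'I_n) : R :=
  (derive1 (derive1 (pbasis D)) (knot D i) *m col j th) 0 0.

Definition vel (R : realType) (N n d : nat) (D : path_data R N n d)
    (th : 'M[R]_(d, n)) (x : 'rV[R]_N.+1) (i : 'I_N.+1) (j : 'I_n) : R :=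
  Num.sg (dq D th i j) * dq D th i j ^+ 2 * x 0 i.

Definition acc (R : realType) (N n d : nat) (D : path_data R N n d)
    (th : 'M[R]_(d, n)) (x : 'rV[R]_N.+1) (i : 'I_N) (j : 'I_n) : R :=
  (ddq D th (lft i) j - dq D th (lft i) j / (2 * ds D i)) * x 0 (lft i)
  + dq D th (lft i) j / (2 * ds D i) * x 0 (rgt i).

(* The explicit case split is needed because 0^-1 = 0 in R. *)
Definition objective (R : realType) (N n d : nat) (D : path_data R N n d)
    (x : 'rV[R]_N.+1) : \bar R :=
  if [exists i : 'I_N, x 0 (lft i) == 0] then +oo%E
  else ((\sum_(i < N) ds D i / Num.sqrt (x 0 (lft i))) ^+ 2)%:E.

Definition feasible (R : realType) (N n d : nat) (D : path_data R N n d)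
    (th : 'M[R]_(d, n)) (x : 'rV[R]_N.+1) : Prop :=
  [/\ nonneg_vec x,
      forall i j, - (vlo D j ^+ 2) <= vel D th x i j <= vhi D j ^+ 2 &
      forall i j, alo D j <= acc D th x i j <= ahi D j].

Definition primal_optimal (R : realType) (N n d : nat) (D : path_data R N n d)
    (th : 'M[R]_(d, n)) (x : 'rV[R]_N.+1) : Prop :=
  feasible D th x /\
  forall y, feasible D th y -> (objective D x <= objective D y)%E.

Definition lagrangian (R : realType) (N n d : nat) (D : path_data R N n d)
    (th : 'M[R]_(d, n)) (x : 'rV[R]_N.+1) (z : multiplier R N n) : \bar R :=
  (objective D x +
   (\sum_(i < N.+1) \sum_(j < n)
      (zvp z i j * (vel D th x i j - vhi D j ^+ 2)
       + zvm z i j * (- vel D th x i j - vlo D j ^+ 2))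
    + \sum_(i < N) \sum_(j < n)
      (zap z i j * (acc D th x i j - ahi D j)
       + zam z i j * (- acc D th x i j + alo D j)))%R%:E)%E.

(* The inner minimum over x >= 0 need not be attained (for zeta = 0 its value
   0 is only approached as x tends to infinity) and may be -oo, hence an
   extended-real infimum. *)
Definition dual_function (R : realType) (N n d : nat) (D : path_data R N n d)
    (th : 'M[R]_(d, n)) (z : multiplier R N n) : \bar R :=
  ereal_inf [set lagrangian D th x z | x in @nonneg_vec R N].

Definition dual_optimal (R : realType) (N n d : nat) (D : path_data R N n d)
    (th : 'M[R]_(d, n)) (z : multiplier R N n) : Prop :=
  nonneg_mult z /\
  forall w, nonneg_mult w -> (dual_function D th w <= dual_function D th z)%E.

(* Partial derivatives with respect to the entries of a matrix argument. *)
Definition gradient (R : realType) (d n : nat) (f : 'M[R]_(d, n) -> R)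
    (th : 'M[R]_(d, n)) : 'M[R]_(d, n) :=
  \matrix_(k, j) 'D_(delta_mx k j) f th.

(* Main.v *)
Require Import Defs.
From mathcomp Require Import all_boot all_order all_algebra.
From mathcomp Require Import all_classical all_reals all_analysis.
From mathcomp Require Import ring lra.
Import Order.TTheory GRing.Theory Num.Theory.
Import numFieldNormedType.Exports.
Local Open Scope classical_set_scope.
Local Open Scope ring_scope.

(* The Lagrangian is, up to the objective (which does not involve theta) and
   constants, a sum of functions of theta that are positively homogeneous of
   degree 2 (the v_ij) or 1 (the a_ij). By Euler's identity its derivative along
   theta is the sum over the constraints g_k <= b_k of deg_k zeta_k g_k, and
   complementary slackness turns this into the sum of deg_k zeta_k b_k >= 0.

   Complementary slackness needs a zero duality gap. As the constraints are
   affine in x and the objective is convex and differentiable where finite,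
   multipliers certifying optimality of x exist by Farkas' lemma applied to the
   objective linearised at x; a small constant vector is feasible, so the
   optimal x_i (i < N) are positive. *)

Set Implicit Arguments.
Unset Strict Implicit.
Unset Printing Implicit Defensive.

(** * Farkas' lemma, linear and affine *)

Lemma scalar_form0 (R : pzRingType) (V : lmodType R) (f : V -> R) :
  scalar f -> f 0 = 0.
Proof.
move=> fL; have := fL 1 0 0; rewrite scaler0 addr0 mul1r.
by move=> /eqP; rewrite -subr_eq0 opprD addNKr oppr_eq0 => /eqP.
Qed.

Lemma scalar_formZ (R : pzRingType) (V : lmodType R) (f : V -> R)
    (t : R) (v : V) :
  scalar f -> f (t *: v) = t * f v.
Proof. by move=> fL; rewrite -[t *: v]addr0 fL scalar_form0// addr0. Qed.

(* Bartl's induction on the number of constraints: if [k0] cannot be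
   dropped, some direction [v1] violates only [k0], and projecting along [v1]
   onto the kernel of [a k0] removes that constraint. *)
Lemma farkas (R : realFieldType) (V : lmodType R) (K : eqType)
    (a : K -> V -> R) (c : V -> R) (s : seq K) :
  uniq s -> (forall k, scalar (a k)) -> scalar c ->
  (forall v, (forall k, k \in s -> a k v <= 0) -> c v <= 0) ->
  exists2 l : K -> R, forall k, 0 <= l k &
    forall v, c v = \sum_(k <- s) l k * a k v.
Proof.
elim: s a c => [|k0 s IH] a c /=.
  move=> _ _ cL cneg; exists (fun=> 0) => // v; rewrite big_nil.
  have := cneg v (fun k h => False_ind _ (notF h)).
  have := cneg (- v) (fun k h => False_ind _ (notF h)).
  have := scalar_formZ (-1) v cL; rewrite scaleN1r; lra.
move=> /andP[k0s us] aL cL cneg.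
case: (pselect (forall v : V, (forall k, k \in s -> a k v <= 0) -> c v <= 0)).
  move=> /(IH a c us aL cL)[l l0 cE].
  exists (fun k => if k == k0 then 0 else l k).
    by move=> k; case: eqP.
  move=> v; rewrite big_cons eqxx mul0r add0r cE; apply: eq_big_seq => k ks.
  by case: eqP => // kk0; rewrite -kk0 ks in k0s.
move=> /existsNP[v1 /not_implyP[av1 /negP]]; rewrite -ltNge => cv1.
have a0v1 : 0 < a k0 v1.
  rewrite ltNge; apply/negP => h; have : c v1 <= 0.
    by apply: cneg => k; rewrite inE => /orP[/eqP->//|]; exact: av1.
  by rewrite leNgt cv1.
pose r v := a k0 v / a k0 v1.
pose pr v := (- r v) *: v1 + v.
have prL (f : V -> R) : scalar f -> scalar (f \o pr).
  move=> fL t u v /=; rewrite /pr !fL /r (aL k0) !mulrDl; ring.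
have [||l l0 cE] := IH (fun k => a k \o pr) (c \o pr) us _ (prL c cL).
- by move=> k; exact: prL.
- move=> v av /=; apply: cneg => k.
  rewrite inE => /orP[/eqP->|]; last exact: av.
  by rewrite /pr (aL k0) /r mulNr divfK ?gt_eqF// addNr.
(* The value of [m] is forced by evaluating the desired identity at [v1]. It is nonnegative since
   [c v1 > 0] while [a k v1 <= 0] for [k] in [s]. *)
pose m := (c v1 - \sum_(k <- s) l k * a k v1) / a k0 v1.
exists (fun k => if k == k0 then m else l k).
  move=> k; case: eqP => // _; rewrite divr_ge0 ?(ltW a0v1)// subr_ge0.
  apply: (le_trans _ (ltW cv1)); rewrite big_seq sumr_le0// => i si.
  by rewrite mulr_ge0_le0// av1.
move=> v; rewrite big_cons eqxx.
rewrite (_ : \sum_(k <- s) _ = \sum_(k <- s) l k * a k v); last first.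
  by apply: eq_big_seq => k ks; case: eqP => // kk0; rewrite -kk0 ks in k0s.
have := cE v; rewrite /= /pr cL.
under eq_bigr do rewrite aL mulrDr mulrCA.
rewrite big_split /= -mulr_sumr /m /r => h.
have -> : c v = r v * c v1 + (- (r v) * c v1 + c v) by ring.
rewrite [X in _ + X]h /r; ring.
Qed.

(** Homogenise: a coordinate [t >= 0] turns the affine constraints into the linear ones
    [a k y - t * b k <= 0]. For [t > 0] rescaling by [t^-1] gives an admissible point; for [t = 0]
    the admissible [x] serves as a base point. *)
Lemma affine_farkas (R : realFieldType) (V : lmodType R) (K : finType)
    (a : K -> V -> R) (b : K -> R) (c : V -> R) (c0 : R) (x : V) :
  (forall k, scalar (a k)) -> scalar c ->
  (forall k, a k x <= b k) ->
  (forall y, (forall k, a k y <= b k) -> c y <= c0) ->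
  exists2 l : K -> R, forall k, 0 <= l k &
    forall y, c y - c0 <= \sum_k l k * (a k y - b k).
Proof.
move=> aL cL xb cb.
pose W : lmodType R := (V * R^o)%type.
pose a' (o : option K) (w : W) : R :=
  if o is Some k then a k w.1 - w.2 * b k else - w.2.
pose c' (w : W) : R := c w.1 - w.2 * c0.
have [||||l l0 cE] := @farkas R W (option K) a' c'
    (None :: [seq Some k | k <- index_enum K]).
- rewrite /= map_inj_uniq ?index_enum_uniq ?andbT; last by move=> ? ? [].
  by apply/mapP => -[].
- move=> [k|] t u v; rewrite /a' /=; last by rewrite /GRing.scale /=; ring.
  by rewrite aL /GRing.scale /=; ring.
- by move=> t u v; rewrite /c' /= cL /GRing.scale /=; ring.
- move=> [y t] h; rewrite /c' /=.
  have t0 : 0 <= t by have := h None (mem_head _ _); rewrite /a' /= oppr_le0.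
  have ay k : a k y <= t * b k.
    have := h (Some k); rewrite inE /= map_f ?mem_index_enum// => /(_ isT).
    by rewrite /a' /= subr_le0.
  move: t0; rewrite le_eqVlt => /orP[/eqP t0|t0].
    rewrite -t0 mul0r subr0.
    (* [y] is a recession direction, so [x + r y] stays admissible *)
    rewrite leNgt; apply/negP => cy.
    have cx : c x <= c0 by exact: cb.
    (* The step length makes [c] equal to [c0 + c y] at the new point, which exceeds [c0]. *)
    have : c ((((c0 - c x) / c y + 1)) *: y + x) <= c0.
      apply: cb => k; rewrite aL.
      have : ((c0 - c x) / c y + 1) * a k y <= 0.
        rewrite mulr_ge0_le0//; last by have := ay k; rewrite -t0 mul0r.
        by rewrite addr_ge0// divr_ge0 ?subr_ge0// ltW.
      by have := xb k; lra.
    by rewrite cL mulrDl divfK ?gt_eqF//; lra.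
  have : c (t^-1 *: y) <= c0.
    by apply: cb => k; rewrite scalar_formZ// mulrC ler_pdivrMr// mulrC.
  by rewrite scalar_formZ// mulrC ler_pdivrMr// mulrC; lra.
exists (l \o some) => [k|y]; first exact: l0.
(* At [t = 1] the multiplier of [- t <= 0] contributes a nonpositive constant; dropping it turns the
   identity into an inequality. *)
have := cE (y, 1); rewrite /c' /= mul1r => ->.
rewrite big_cons big_map /= (eq_bigr (fun k => l (Some k) * (a k y - b k))).
  by rewrite gerDr mulrN1 oppr_le0.
by move=> k _; rewrite mul1r.
Qed.

(** * Uniform indexing of constraints and multipliers *)

(* The four families of inequality constraints, normalised to
   [constr k y <= bound k]; [multiplier_of] and [weight] convert between the
   record of multiplier matrices and multiplier functions on these indices. *)
Definition constraint (N n : nat) : finType :=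
  (('I_N.+1 * 'I_n + 'I_N.+1 * 'I_n) + ('I_N * 'I_n + 'I_N * 'I_n))%type.

Definition constr (R : realType) (N n d : nat) (D : path_data R N n d)
    (th : 'M[R]_(d, n)) (k : constraint N n) (y : 'rV[R]_N.+1) : R :=
  match k with
  | inl (inl ij) => vel D th y ij.1 ij.2
  | inl (inr ij) => - vel D th y ij.1 ij.2
  | inr (inl ij) => acc D th y ij.1 ij.2
  | inr (inr ij) => - acc D th y ij.1 ij.2
  end.

Definition bound (R : realType) (N n d : nat) (D : path_data R N n d)
    (k : constraint N n) : R :=
  match k with
  | inl (inl ij) => vhi D ij.2 ^+ 2
  | inl (inr ij) => vlo D ij.2 ^+ 2
  | inr (inl ij) => ahi D ij.2
  | inr (inr ij) => - alo D ij.2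
  end.

Definition weight (R : realType) (N n : nat) (z : multiplier R N n)
    (k : constraint N n) : R :=
  match k with
  | inl (inl ij) => zvp z ij.1 ij.2
  | inl (inr ij) => zvm z ij.1 ij.2
  | inr (inl ij) => zap z ij.1 ij.2
  | inr (inr ij) => zam z ij.1 ij.2
  end.

Definition multiplier_of (R : realType) (N n : nat) (l : constraint N n -> R) :
    multiplier R N n :=
  Multiplier (\matrix_(i, j) l (inl (inl (i, j))))
    (\matrix_(i, j) l (inl (inr (i, j))))
    (\matrix_(i, j) l (inr (inl (i, j))))
    (\matrix_(i, j) l (inr (inr (i, j)))).

Lemma weight_multiplier_of (R : realType) (N n : nat)
    (l : constraint N n -> R) : weight (multiplier_of l) = l.
Proof. by apply/funext => -[[]|[]] [i j]; rewrite /= mxE. Qed.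

Lemma nonneg_multP (R : realType) (N n : nat) (z : multiplier R N n) :
  nonneg_mult z <-> forall k, 0 <= weight z k.
Proof.
split=> [[h1 h2 h3 h4] [[]|[]] [i j] //=|h].
split=> i j; [exact: (h (inl (inl (i, j)))) | exact: (h (inl (inr (i, j)))) |
  exact: (h (inr (inl (i, j)))) | exact: (h (inr (inr (i, j))))].
Qed.

Lemma constr_scalar (R : realType) (N n d : nat) (D : path_data R N n d)
    (th : 'M[R]_(d, n)) (k : constraint N n) : scalar (constr D th k).
Proof.
by case: k => [[]|[]] [i j] t u v; rewrite /= /vel /acc !mxE; ring.
Qed.

Lemma feasibleP (R : realType) (N n d : nat) (D : path_data R N n d)
    (th : 'M[R]_(d, n)) (y : 'rV[R]_N.+1) :
  feasible D th y <->
  nonneg_vec y /\ forall k, constr D th k y <= bound D k.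
Proof.
split=> [[y0 hv ha]|[y0 h]].
  split=> // -[[]|[]] [i j] /=.
  - by have /andP[] := hv i j.
  - by have /andP[h _] := hv i j; rewrite lerNl.
  - by have /andP[] := ha i j.
  - by have /andP[h _] := ha i j; rewrite lerN2.
split=> // i j.
  rewrite (h (inl (inl (i, j)))) andbT lerNl.
  exact: (h (inl (inr (i, j)))).
rewrite (h (inr (inl (i, j)))) andbT -lerN2.
exact: (h (inr (inr (i, j)))).
Qed.

Lemma lagrangianE (R : realType) (N n d : nat) (D : path_data R N n d)
    (th : 'M[R]_(d, n)) (y : 'rV[R]_N.+1) (z : multiplier R N n) :
  lagrangian D th y z =
  (objective D y +
   (\sum_k weight z k * (constr D th k y - bound D k))%R%:E)%E.
Proof.
rewrite /lagrangian big_sumType /= !big_sumType /=.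
congr (_ + _%:E)%E; congr (_ + _).
  by rewrite -big_split pair_bigA.
rewrite -big_split pair_bigA /=; apply: eq_bigr => ij _.
by rewrite opprK.
Qed.

(** * Positivity of the optimal speeds *)

Lemma exists_small_positive (R : realFieldType) (K : finType) (a b : K -> R) :
  (forall k, 0 < b k) -> exists2 e, 0 < e & forall k, e * a k <= b k.
Proof.
move=> b0; pose s := \sum_k `|a k| / b k.
have s0 : 0 <= s by apply: sumr_ge0 => k _; rewrite divr_ge0// ltW.
exists (1 + s)^-1 => [|k]; first by rewrite invr_gt0; lra.
rewrite ler_pdivrMl; last by lra.
apply: (le_trans (ler_norm _)); rewrite -ler_pdivrMr//.
rewrite /s (bigD1 k)//=.
have : 0 <= \sum_(i | i != k) `|a i| / b i.
  by apply: sumr_ge0 => i _; rewrite divr_ge0// ltW.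
lra.
Qed.

Lemma bound_gt0 (R : realType) (N n d : nat) (D : path_data R N n d) :
  (forall j, vlo D j < 0 < vhi D j) -> (forall j, alo D j < 0 < ahi D j) ->
  forall k, 0 < bound D k.
Proof.
move=> vlim alim [[]|[]] [i j] /=.
- by have /andP[_ h] := vlim j; rewrite exprn_gt0.
- by have /andP[h _] := vlim j; rewrite -sqrrN exprn_gt0// oppr_gt0.
- by have /andP[] := alim j.
- by have /andP[h _] := alim j; rewrite oppr_gt0.
Qed.

(** The real-valued square root of the objective. It is meaningful only at positive speeds: a zero
    speed contributes 0 here, not infinity. *)
Definition traversal_time (R : realType) (N n d : nat) (D : path_data R N n d)
    (x : 'rV[R]_N.+1) : R :=
  \sum_(i < N) ds D i / Num.sqrt (x 0 (lft i)).

Lemma objective_pos (R : realType) (N n d : nat) (D : path_data R N n d)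
    (x : 'rV[R]_N.+1) :
  (forall i : 'I_N, 0 < x 0 (lft i)) ->
  objective D x = (traversal_time D x ^+ 2)%:E.
Proof.
move=> x0; rewrite /objective; case: existsP => // -[i /eqP xi].
by have := x0 i; rewrite xi ltxx.
Qed.

(** All bounds are positive, so a small constant vector is feasible with finite objective; the
    optimal objective is then finite too. *)
Lemma primal_optimal_pos (R : realType) (N n d : nat) (D : path_data R N n d)
    (th : 'M[R]_(d, n)) (x : 'rV[R]_N.+1) :
  (forall j, vlo D j < 0 < vhi D j) -> (forall j, alo D j < 0 < ahi D j) ->
  primal_optimal D th x -> forall i : 'I_N, 0 < x 0 (lft i).
Proof.
move=> vlim alim [[x0 _ _] xmin] i.
have [e e0 he] := exists_small_positive (fun k => constr D th k (const_mx 1))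
  (bound_gt0 vlim alim).
have ye : forall i, 0 < (const_mx e : 'rV[R]_N.+1) 0 i by move=> l; rewrite mxE.
have : (objective D x <= objective D (const_mx e))%E.
  apply: xmin; apply/feasibleP; split=> [l|k]; first exact: ltW.
  rewrite (_ : const_mx e = e *: const_mx 1); last first.
    by apply/rowP => l; rewrite !mxE mulr1.
  by rewrite (scalar_formZ _ _ (constr_scalar D th k)).
rewrite (objective_pos D (fun l => ye (lft l))) /objective.
case: ifPn => [_|]; first by rewrite leye_eq.
rewrite negb_exists => /forallP/(_ i) xi _.
by rewrite lt_def xi x0.
Qed.

(** * First-order optimality condition *)

(* [slope D x] is minus twice the differential of [traversal_time] at [x]. *)
Definition slope (R : realType) (N n d : nat) (D : path_data R N n d)
    (x h : 'rV[R]_N.+1) : R :=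
  \sum_(i < N) ds D i * h 0 (lft i) / Num.sqrt (x 0 (lft i)) ^+ 3.

Lemma slope_scalar (R : realType) (N n d : nat) (D : path_data R N n d)
    (x : 'rV[R]_N.+1) : scalar (slope D x).
Proof.
move=> t u v; rewrite /slope mulr_sumr -big_split; apply: eq_bigr => i _ /=.
by rewrite !mxE; ring.
Qed.

(** Convexity of the inverse square root, without calculus: with [w] and [u] the roots of [x] and
    [y], the gap factors explicitly with a square. *)
Lemma inv_sqrt_tangent (R : rcfType) (x y : R) : 0 < x -> 0 < y ->
  (Num.sqrt x)^-1 - (y - x) / Num.sqrt x ^+ 3 / 2 <= (Num.sqrt y)^-1.
Proof.
move=> x0 y0; have w0 : 0 < Num.sqrt x by rewrite sqrtr_gt0.
have u0 : 0 < Num.sqrt y by rewrite sqrtr_gt0.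
have -> : y - x = Num.sqrt y ^+ 2 - Num.sqrt x ^+ 2.
  by rewrite !sqr_sqrtr ?ltW.
move: (Num.sqrt x) (Num.sqrt y) w0 u0 => w u w0 u0.
rewrite -subr_ge0.
have -> : u^-1 - (w^-1 - (u ^+ 2 - w ^+ 2) / w ^+ 3 / 2) =
    (w - u) ^+ 2 * (2 * w + u) / (2 * w ^+ 3 * u).
  by field; rewrite ?gt_eqF.
rewrite divr_ge0// mulr_ge0 ?sqr_ge0 ?exprn_ge0//; try lra.
by rewrite mulr_ge0// ?exprn_ge0//; lra.
Qed.

Lemma traversal_time_tangent (R : realType) (N n d : nat)
    (D : path_data R N n d) (x y : 'rV[R]_N.+1) :
  (forall i : 'I_N, 0 < ds D i) ->
  (forall i : 'I_N, 0 < x 0 (lft i)) -> (forall i : 'I_N, 0 < y 0 (lft i)) ->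
  traversal_time D x - slope D x (y - x) / 2 <= traversal_time D y.
Proof.
move=> ds0 x0 y0; rewrite /traversal_time /slope mulr_suml -sumrB.
apply: ler_sum => i _.
have h := inv_sqrt_tangent (x0 i) (y0 i).
have := ler_wpM2l (ltW (ds0 i)) h; apply: le_trans.
by rewrite !mxE le_eqVlt; apply/orP; left; apply/eqP; ring.
Qed.

Lemma traversal_time_ge0 (R : realType) (N n d : nat)
    (D : path_data R N n d) (x : 'rV[R]_N.+1) :
  (forall i : 'I_N, 0 < ds D i) -> 0 <= traversal_time D x.
Proof.
by move=> ds0; apply: sumr_ge0 => i _; rewrite divr_ge0 ?sqrtr_ge0// ltW.
Qed.

Lemma slope_continuous (R : realType) (N n d : nat) (D : path_data R N n d)
    (x h : 'rV[R]_N.+1) : (forall i : 'I_N, 0 < x 0 (lft i)) ->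
  slope D (x + t *: h) h @[t --> (0 : R)] --> slope D x h.
Proof.
move=> x0; rewrite /slope; apply: cvg_big; first exact: add_continuous.
move=> i _; apply: cvgMr; apply: cvgV.
  by rewrite gt_eqF// exprn_gt0 ?sqrtr_gt0.
apply: (@cvg_comp _ _ _ (fun t : R => Num.sqrt ((x + t *: h) 0 (lft i)))
  (fun u => u ^+ 3) _ (nbhs (Num.sqrt (x 0 (lft i))))); last first.
  exact: exprn_continuous.
apply: (@cvg_comp _ _ _ (fun t : R => (x + t *: h) 0 (lft i)) Num.sqrt _
  (nbhs (x 0 (lft i)))); last exact: sqrt_continuous.
have xh : x 0 (lft i) + t * h 0 (lft i) @[t --> (0 : R)] -->
    x 0 (lft i) + 0 * h 0 (lft i).
  by apply: cvgD; [exact: cvg_cst|apply: cvgMl; exact: cvg_id].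
rewrite mul0r addr0 in xh; apply: cvg_trans xh; apply: near_eq_cvg.
by near=> t; rewrite !mxE.
Unshelve. all: by end_near.
Qed.

(** If the slope were positive at [x], by continuity it would stay so at a nearby point [u] of the
    segment towards [y]. The tangent inequality at [u], evaluated at [x], would then make [u]
    strictly faster than [x]. *)
Lemma primal_optimal_slope (R : realType) (N n d : nat) (D : path_data R N n d)
    (th : 'M[R]_(d, n)) (x y : 'rV[R]_N.+1) :
  (forall i : 'I_N, 0 < ds D i) -> (forall i : 'I_N, 0 < x 0 (lft i)) ->
  primal_optimal D th x -> feasible D th y -> slope D x (y - x) <= 0.
Proof.
move=> ds0 xpos [/feasibleP[x0 xb] xmin] /feasibleP[y0 yb].
rewrite leNgt; apply/negP => /(cvgr_gt _ (slope_continuous (h := y - x) xpos)).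
move=> /nbhs_ballP[e /= e0 he].
have [t [t0 t1 te]] : exists t : R, [/\ 0 < t, t < 1 & t < e].
  by exists (Num.min (e / 2) (1 / 2)); rewrite !gt_min lt_min; split; lra.
have : 0 < slope D (x + t *: (y - x)) (y - x).
  by apply: he; rewrite /ball /= sub0r normrN gtr0_norm.
apply/negP; rewrite -leNgt.
set u := x + t *: (y - x).
have uE : u = (1 - t) *: x + t *: y.
  by apply/rowP => i; rewrite !mxE; ring.
have upos (i : 'I_N) : 0 < u 0 (lft i).
  rewrite uE !mxE; apply: ltr_wpDr; first by rewrite mulr_ge0 ?y0 ?ltW.
  by rewrite mulr_gt0// subr_gt0.
have : (objective D x <= objective D u)%E.
  apply: xmin; apply/feasibleP; split=> [i|k].
    rewrite uE !mxE; have := x0 i; have := y0 i => yi xi.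
    by rewrite addr_ge0 // mulr_ge0 ?subr_ge0 // ltW.
  rewrite uE constr_scalar (scalar_formZ _ _ (constr_scalar D th k)).
  have -> : bound D k = (1 - t) * bound D k + t * bound D k by ring.
  by rewrite lerD // ler_wpM2l ?subr_ge0 // ltW.
rewrite (objective_pos D xpos) (objective_pos D upos) lee_fin.
rewrite ler_pXn2r ?nnegrE ?traversal_time_ge0 // => xu.
have := traversal_time_tangent ds0 upos xpos.
have -> : x - u = (- t) *: (y - x).
  by apply/rowP => i; rewrite !mxE; ring.
rewrite (scalar_formZ _ _ (slope_scalar D u)) => h.
by rewrite -(pmulr_rle0 _ t0); lra.
Qed.

(** * Strong duality and complementary slackness *)

(* The KKT multipliers: since all the constraints are affine, the affine Farkas
   lemma applies directly to the linearisation of the objective at [x]. *)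
Lemma exists_optimal_multiplier (R : realType) (N n d : nat)
    (D : path_data R N n d) (th : 'M[R]_(d, n)) (x : 'rV[R]_N.+1) :
  (forall i : 'I_N, 0 < ds D i) -> (forall i : 'I_N, 0 < x 0 (lft i)) ->
  primal_optimal D th x ->
  exists2 w, nonneg_mult w & (objective D x <= dual_function D th w)%E.
Proof.
move=> ds0 xpos xopt; have [/feasibleP[x0 xb] xmin] := xopt.
pose T := traversal_time D x.
have T0 : 0 <= T by exact: traversal_time_ge0.
(* The sign constraints [0 <= y 0 i] join the system; their multipliers are discarded later, as
   their terms are nonpositive on nonnegative vectors. *)
pose a (k : constraint N n + 'I_N.+1) (y : 'rV[R]_N.+1) : R :=
  match k with inl k => constr D th k y | inr i => - y 0 i end.
pose b (k : constraint N n + 'I_N.+1) : R :=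
  if k is inl k then bound D k else 0.
(* This is minus the differential at [x] of the squared traversal time. *)
pose c y := T * slope D x y.
have aL k : scalar (a k).
  case: k => [k|i]; first exact: constr_scalar.
  by move=> t u v; rewrite /a !mxE; ring.
have cL : scalar c by move=> t u v; rewrite /c slope_scalar; ring.
have feas y : (forall k, a k y <= b k) -> feasible D th y.
  move=> h; apply/feasibleP; split=> [i|k]; last exact: (h (inl k)).
  by have := h (inr i); rewrite /= oppr_le0.
have [|y ab|l l0 hl] := affine_farkas (b := b) (c0 := c x) (x := x) aL cL.
- by case=> [k|i] /=; [exact: xb|rewrite oppr_le0].
- rewrite /c ler_wpM2l// -subr_le0.
  have := primal_optimal_slope ds0 xpos xopt (feas _ ab).
  by rewrite -scaleN1r addrC slope_scalar; lra.
pose w : multiplier R N n := multiplier_of (fun k => l (inl k)).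
exists w; first by apply/nonneg_multP => k; rewrite weight_multiplier_of.
rewrite /dual_function; apply: le_ereal_inf_tmp => _ [y y0 <-].
rewrite lagrangianE weight_multiplier_of.
rewrite {2}/objective; case: ifPn => [_|].
  by rewrite addye// leey.
rewrite negb_exists => /forallP y_neq0.
have ypos (i : 'I_N) : 0 < y 0 (lft i) by rewrite lt_def y_neq0 y0.
rewrite (objective_pos D xpos) -EFinD lee_fin -/(traversal_time D y).
have := hl y; rewrite big_sumType /=.
have : \sum_(i < N.+1) l (inr i) * (- y 0 i - 0) <= 0.
  by apply: sumr_le0 => i _; rewrite subr0 mulr_ge0_le0// oppr_le0.
have := traversal_time_tangent ds0 xpos ypos.
have -> : y - x = (-1) *: x + y by rewrite scaleN1r addrC.
rewrite slope_scalar /c -/T.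
set S := traversal_time D y; set sx := slope D x x; set sy := slope D x y.
set A := \sum_(i : constraint N n) _; set B := \sum_(i < N.+1) _.
move=> h1 h2 h3.
(* The square is bounded below by its own tangent, [S ^+ 2 >= T ^+ 2 + 2 * T * (S - T)], and [S - T]
   by the tangent of the traversal time. *)
have : 0 <= T * (S - (T - (-1 * sx + sy) / 2)) by rewrite mulr_ge0// subr_ge0.
have := sqr_ge0 (S - T).
by nra.
Qed.

(** The objective at [x] is at most the dual value at [w], hence at [z], hence the Lagrangian at [x]
    and [z]. The latter adds only nonpositive terms to the objective, so each of them vanishes. *)
Lemma complementary_slackness (R : realType) (N n d : nat)
    (D : path_data R N n d) (th : 'M[R]_(d, n)) (x : 'rV[R]_N.+1)
    (z : multiplier R N n) :
  (forall i : 'I_N, 0 < ds D i) -> (forall i : 'I_N, 0 < x 0 (lft i)) ->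
  primal_optimal D th x -> dual_optimal D th z ->
  forall k, weight z k * constr D th k x = weight z k * bound D k.
Proof.
move=> ds0 xpos xopt [/nonneg_multP z0 zmax].
have [w w0 xw] := exists_optimal_multiplier ds0 xpos xopt.
have [/feasibleP[x0 xb] _] := xopt.
have : (objective D x <= lagrangian D th x z)%E.
  apply: (le_trans xw); apply: (le_trans (zmax w w0)).
  by apply: ereal_inf_lbound; exists x.
rewrite lagrangianE (objective_pos D xpos) -EFinD lee_fin lerDl => sum0.
have le0 k : weight z k * (constr D th k x - bound D k) <= 0.
  by rewrite mulr_ge0_le0// subr_le0.
have /eqP : \sum_k - (weight z k * (constr D th k x - bound D k)) = 0.
  apply/eqP; rewrite sumrN oppr_eq0 eq_le sum0 andbT.
  by apply: sumr_le0 => k _.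
rewrite psumr_eq0 => [/allP h k|k _]; last by rewrite oppr_ge0.
have := h k (mem_index_enum k); rewrite /= oppr_eq0 mulrBr subr_eq0.
by move=> /eqP.
Qed.

(** * Differentiability in the basis weights [th] *)

(** The function is [v] times its absolute value, with derivative [2 * |u|]; the jump of the sign at
    0 is harmless. *)
Lemma sg_sqr_differentiable (R : realType) (u : R) :
  differentiable (fun v : R => Num.sg v * v ^+ 2) u.
Proof.
apply/derivable1_diffP; apply/cvg_ex; exists (2 * `|u|).
apply/cvgrPdist_le => e e0; near=> h.
have h0 : h != 0 by near: h; exact: nbhs_dnbhs_neq.
have he : `|h| <= e.
  near: h; apply: (@nbhs_dnbhs _ (0 : R)); apply/nbhs_ballP; exists e => //= t.
  by rewrite /ball /= sub0r normrN => /ltW.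
have sgE (v : R) : Num.sg v * v ^+ 2 = `|v| * v.
  by rewrite expr2 mulrA -normrEsg.
rewrite /= !sgE (_ : h *: 1 = h); last by rewrite /GRing.scale /= mulr1.
(* the Taylor remainder of [v |-> |v| v] is at most [h ^ 2], also across [0] *)
have key : `|2 * `|u| * h - (`|h + u| * (h + u) - `|u| * u)| <= h ^+ 2.
  rewrite ler_norml; case: (ger0P u) => u0; case: (ger0P (h + u)) => hu;
    apply/andP; split; nra.
apply: le_trans he; rewrite -(ler_pM2r (_ : 0 < `|h|)) ?normr_gt0//.
rewrite -!normrM -(expr2 h) [leRHS]ger0_norm ?sqr_ge0//.
apply: le_trans key; rewrite le_eqVlt; apply/orP; left; apply/eqP; congr `|_|.
by rewrite /GRing.scale /= mulrBl [X in _ - X = _]mulrAC mulVf// mul1r.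
Unshelve. all: by end_near.
Qed.

Lemma differentiable_bigsum (R : numFieldType) (V W : normedModType R)
    (K : Type) (s : seq K) (f : K -> V -> W) (v : V) :
  (forall k, differentiable (f k) v) ->
  differentiable (fun u => \sum_(k <- s) f k u) v.
Proof.
move=> df; elim: s => [|k s IH].
  rewrite (_ : (fun _ => _) = cst 0); first exact: differentiable_cst.
  by apply/funext => u; rewrite big_nil.
rewrite (_ : (fun _ => _) = f k + fun u => \sum_(k <- s) f k u).
  exact: differentiableD.
by apply/funext => u; rewrite big_cons.
Qed.

Lemma mulmx_col_differentiable (R : realType) (d n : nat) (p : 'rV[R]_d)
    (j : 'I_n) (th : 'M[R]_(d, n)) :
  differentiable (fun th' : 'M[R]_(d, n) => (p *m col j th') 0 0 : R) th.
Proof.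
rewrite (_ : (fun _ => _) =
    fun th' : 'M[R]_(d, n) =>
      \sum_(k <- index_enum 'I_d) p 0 k *: (th' k j : R^o)); last first.
  by apply/funext => th'; rewrite mxE; apply: eq_bigr => k _; rewrite mxE.
apply: differentiable_bigsum => k; apply: (@differentiableZ R _ R^o).
exact: differentiable_coord.
Qed.

Lemma vel_differentiable (R : realType) (N n d : nat) (D : path_data R N n d)
    (x : 'rV[R]_N.+1) (i : 'I_N.+1) (j : 'I_n) (th : 'M[R]_(d, n)) :
  differentiable (fun th' => vel D th' x i j) th.
Proof.
apply: (@differentiableZl _ _ R^o _ (x 0 i)).
apply: (@differentiable_comp _ _ R^o R^o (fun th' => dq D th' i j)
  (fun v : R => Num.sg v * v ^+ 2)); first exact: mulmx_col_differentiable.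
exact: sg_sqr_differentiable.
Qed.

Lemma acc_differentiable (R : realType) (N n d : nat) (D : path_data R N n d)
    (x : 'rV[R]_N.+1) (i : 'I_N) (j : 'I_n) (th : 'M[R]_(d, n)) :
  differentiable (fun th' => acc D th' x i j) th.
Proof.
have dL := mulmx_col_differentiable (derive1 (pbasis D) (knot D (lft i))) j th.
have ddL := mulmx_col_differentiable
  (derive1 (derive1 (pbasis D)) (knot D (lft i))) j th.
have dcL := @differentiableZl _ _ R^o _ (2 * ds D i)^-1 _ dL.
apply: (@differentiableD _ _ R^o).
  apply: (@differentiableZl _ _ R^o _ (x 0 (lft i))).
  exact: (@differentiableB _ _ R^o).
exact: (@differentiableZl _ _ R^o _ (x 0 (rgt i))).
Qed.

Lemma constr_differentiable (R : realType) (N n d : nat) (D : path_data R N n d)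
    (x : 'rV[R]_N.+1) (k : constraint N n) (th : 'M[R]_(d, n)) :
  differentiable (fun th' => constr D th' k x) th.
Proof.
case: k => [[]|[]] [i j] /=.
- exact: vel_differentiable.
- by apply: (@differentiableN _ _ R^o); exact: vel_differentiable.
- exact: acc_differentiable.
- by apply: (@differentiableN _ _ R^o); exact: acc_differentiable.
Qed.

(** * Euler's identity and the final inequality *)

Lemma sum_gradient (R : realType) (d n : nat) (f : 'M[R]_(d, n) -> R)
    (th h : 'M[R]_(d, n)) : differentiable f th ->
  \sum_(k < d) \sum_(j < n) gradient f th k j * h k j = 'D_h f th.
Proof.
move=> df; rewrite [in RHS](matrix_sum_delta h) deriveE// linear_sum.
apply: eq_bigr => k _; rewrite linear_sum; apply: eq_bigr => j _.
by rewrite linearZ mxE deriveE// mulrC.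
Qed.

Definition degree (N n : nat) (k : constraint N n) : nat :=
  if k is inl _ then 2 else 1.

(** Positive scaling preserves the sign factor in [vel]; a negative [t] would flip it. *)
Lemma constr_homogeneous (R : realType) (N n d : nat) (D : path_data R N n d)
    (x : 'rV[R]_N.+1) (th : 'M[R]_(d, n)) (k : constraint N n) (t : R) :
  0 < t -> constr D (t *: th) k x = t ^+ degree k * constr D th k x.
Proof.
move=> t0.
have colZ (j : 'I_n) : col j (t *: th) = t *: col j th.
  by apply/matrixP => a b; rewrite !mxE.
have velZ i j : vel D (t *: th) x i j = t ^+ 2 * vel D th x i j.
  rewrite /vel /dq colZ -scalemxAr mxE sgrM gtr0_sg// mul1r; ring.
have accZ i j : acc D (t *: th) x i j = t * acc D th x i j.
  by rewrite /acc /dq /ddq colZ -!scalemxAr !mxE; ring.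
by case: k => [[]|[]] [i j] /=; rewrite ?velZ ?accZ ?mulrN.
Qed.

Lemma euler_constr (R : realType) (N n d : nat) (D : path_data R N n d)
    (x : 'rV[R]_N.+1) (th : 'M[R]_(d, n)) (l : constraint N n -> R) (c : R) :
  'D_th (fun th' => c + \sum_k l k * (constr D th' k x - bound D k)) th =
  \sum_k (degree k)%:R * (l k * constr D th k x).
Proof.
rewrite /derive; apply: (@cvg_lim R^o); first exact: Rhausdorff.
(* For a degree [m] equal to 1 or 2, [(1 + h) ^+ m - 1 = m * h + (m - 1) * h ^+ 2]. The difference
   quotient along [th] is thus exactly [s + h * s2] for small nonzero [h]. *)
pose s2 := \sum_k ((degree k).-1)%:R * (l k * constr D th k x).
set s := \sum_k (degree k)%:R * _.
have lim0 : s + h * s2 @[h --> (0 : R)^'] --> s + 0 * s2.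
  by apply: cvgD; [exact: cvg_cst|apply: cvgMl; exact: nbhs_dnbhs].
rewrite mul0r addr0 in lim0; apply: cvg_trans lim0; apply: near_eq_cvg.
near=> h.
have h0 : h != 0 by near: h; exact: nbhs_dnbhs_neq.
have h1 : 0 < 1 + h.
  near: h; apply: (@nbhs_dnbhs _ (0 : R)); apply/nbhs_ballP; exists 1 => //= t.
  rewrite /ball /= sub0r normrN => /ltr_normlP[]; lra.
rewrite /= (_ : h *: th + th = (1 + h) *: th); last first.
  by rewrite scalerDl scale1r addrC.
apply: (mulfI h0); rewrite /GRing.scale /= mulrA mulfV// mul1r.
rewrite opprD addrACA subrr add0r -sumrB /s /s2.
rewrite mulr_sumr -big_split mulr_sumr /=.
apply: eq_bigr => k _; rewrite constr_homogeneous//.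
by case: k => k /=; ring.
Unshelve. all: by end_near.
Qed.

Theorem theorem1 (R : realType) (N n d : nat)
  (N_gt0 : (0 < N)%N) (n_gt0 : (0 < n)%N) (d_gt0 : (0 < d)%N)
  (D : path_data R N n d)
  (knot_first : knot D ord0 = 0)
  (knot_last : knot D ord_max = 1)
  (ds_gt0 : forall i : 'I_N, 0 < ds D i)
  (basis_derivable : forall t : R, derivable (pbasis D) t 1)
  (basis_derivable2 : forall t : R, derivable (derive1 (pbasis D)) t 1)
  (vlim : forall j : 'I_n, vlo D j < 0 < vhi D j)
  (alim : forall j : 'I_n, alo D j < 0 < ahi D j)
  (th : 'M[R]_(d, n)) (x : 'rV[R]_N.+1) (z : multiplier R N n)
  (x_opt : primal_optimal D th x)
  (z_opt : dual_optimal D th z) :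
  let LI := fun th' : 'M[R]_(d, n) => lagrangian D th' x z in
  [/\ forall th' : 'M[R]_(d, n), LI th' \is a fin_num,
      differentiable (fun th' : 'M[R]_(d, n) => fine (LI th')) th
    & 0 <= \sum_(k < d) \sum_(j < n)
             gradient (fun th' : 'M[R]_(d, n) => fine (LI th')) th k j * th k j].
Proof.
move=> LI; have xpos := primal_optimal_pos vlim alim x_opt.
(* Positivity of [x] makes the objective a finite constant, so the Lagrangian is real at every
   [th']. *)
have LIE th' : LI th' = (traversal_time D x ^+ 2 +
    \sum_k weight z k * (constr D th' k x - bound D k))%:E.
  by rewrite /LI lagrangianE (objective_pos D xpos) -EFinD.
have fLIE : (fun th' => fine (LI th')) = (fun th' => traversal_time D x ^+ 2 +
    \sum_k weight z k * (constr D th' k x - bound D k)).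
  by apply/funext => th'; rewrite LIE.
have dLI : differentiable (fun th' : 'M[R]_(d, n) => fine (LI th')) th.
  rewrite fLIE; apply: (@differentiableD _ _ R^o).
    exact: differentiable_cst.
  apply: (@differentiable_bigsum _ _ R^o) => k.
  apply: (@differentiableZ _ _ R^o).
  apply: (@differentiableB _ _ R^o); last exact: differentiable_cst.
  exact: constr_differentiable.
split=> // [th'|]; first by rewrite LIE.
rewrite sum_gradient// fLIE euler_constr; apply: sumr_ge0 => k _.
rewrite (complementary_slackness ds_gt0 xpos x_opt z_opt).
have [/nonneg_multP z0 _] := z_opt.
by rewrite mulr_ge0// mulr_ge0// ltW// bound_gt0.
Qed.
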